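(* Let $d\ge1$ and let $\Omega=H_1\times H_2\times\cdots\times H_d$ be a product of finite nonempty sets, equipped with the $\ell_0$ metric $d(x,y)=|\{i:x_i\ne y_i\}|$. Then $\Omega$ has Brunn-Minkowski curvature at least $\frac{1}{2d}$; that is, for all nonempty $S,T\subseteq\Omega$, $$|\widehat{m}(S,T)|\ge\sqrt{|S||T|}\;e^{\frac{1}{16d}d_*(S,T)^2}.$$
   Context: For points $a,b$, the symmetric discrete midpoints are $$\widehat{m}(a,b)=\{u: d(a,u)=\lfloor d(a,b)/2\rfloor,\ d(a,u)+d(u,b)=d(a,b)\}\cup\{u: d(a,u)=\lceil d(a,b)/2\rceil,\ d(a,u)+d(u,b)=d(a,b)\},$$ and $\widehat{m}(S,T)=\bigcup_{s\in S,t\in T}\widehat{m}(s,t)$. Also $d_*(S,T)=\min\{d(s,t):s\in S,t\in T\}$. The Brunn-Minkowski curvature is the supremum of the values $K$ such that $|\widehat{m}(S,T)|\ge\sqrt{|S||T|}\,e^{\frac K8 d_*(S,T)^2}$ for all nonempty sets $S,T$. *)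

(* Defs.v *)
From mathcomp Require Import classical_sets reals ereal sequences exp.
(* Imported last, so that set0 and \bigcup refer to finite sets. *)
From mathcomp Require Import all_boot all_order all_algebra.

Set Implicit Arguments.
Unset Strict Implicit.
Unset Printing Implicit Defensive.

Import Order.TTheory GRing.Theory Num.Theory.

Section FiniteMetric.
Variables (T : finType) (dist : T -> T -> nat).

Definition midpoints (a b : T) : {set T} :=
  [set u | (dist a u == (dist a b)./2) && (dist a u + dist u b == dist a b)]
  :|: [set u | (dist a u == uphalf (dist a b))
               && (dist a u + dist u b == dist a b)].

Definition set_midpoints (S U : {set T}) : {set T} :=
  \bigcup_(s in S) \bigcup_(t in U) midpoints s t.

Definition diameter : nat := \max_(p : T * T) dist p.1 p.2.

(* The neutral value [diameter] bounds every distance, so on nonempty sets this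
   is the minimum: see set_dist_le and set_dist_attained below. *)
Definition set_dist (S U : {set T}) : nat :=
  \big[minn/diameter]_(p in setX S U) dist p.1 p.2.

Lemma set_dist_le (S U : {set T}) s t :
  s \in S -> t \in U -> set_dist S U <= dist s t.
Proof.
move=> sS tU; have stP : (s, t) \in setX S U by rewrite inE /= sS tU.
rewrite /set_dist -big_filter.
have: (s, t) \in [seq p <- index_enum (T * T)%type | p \in setX S U].
  by rewrite mem_filter stP mem_index_enum.
elim: [seq _ <- _ | _] => [//|p r IHr].
rewrite inE big_cons geq_min => /predU1P[<- | /IHr ->]; first by rewrite leqnn.
by rewrite orbT.
Qed.

Lemma set_dist_attained (S U : {set T}) : S != set0 -> U != set0 ->
  exists s t, [/\ s \in S, t \in U & set_dist S U = dist s t].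
Proof.
move=> /set0Pn[s0 s0S] /set0Pn[t0 t0U].
have [[s [t [sS tU E]]] | E] :
    (exists s t, [/\ s \in S, t \in U & set_dist S U = dist s t])
    \/ set_dist S U = diameter.
- rewrite /set_dist; elim/big_ind: _ => [|x y Hx Hy|[s t]].
  + by right.
  + by rewrite /minn; case: ifP.
  + by rewrite inE => /andP[sS tU]; left; exists s, t.
- by exists s, t.
- exists s0, t0; split => //; apply/eqP.
  rewrite eqn_leq set_dist_le //= E.
  exact: (leq_bigmax (s0, t0) (F := fun p : T * T => dist p.1 p.2)).
Qed.

End FiniteMetric.

Local Open Scope ring_scope.

Definition brunn_minkowski (R : realType) (T : finType) (dist : T -> T -> nat)
    (K : R) : Prop :=
  forall S U : {set T}, S != set0 -> U != set0 ->
    Num.sqrt (#|S|%:R * #|U|%:R)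
      * expR (K / 8%:R * (set_dist dist S U)%:R ^+ 2)
    <= #|set_midpoints dist S U|%:R.

(* Extended-real valued: on a one-point space every K is admissible and the
   curvature is +oo. *)
Definition bm_curvature (R : realType) (T : finType) (dist : T -> T -> nat) :
    \bar R :=
  ereal_sup [set K%:E | K in [set K : R | brunn_minkowski dist K]]%classic.

Definition l0_dist (d : nat) (H : 'I_d -> finType)
    (x y : {dffun forall i : 'I_d, H i}) : nat :=
  #|[set i : 'I_d | x i != y i]|.

(* Main.v *)
(* Given (a, b), pair up the coordinates where a and b differ into blocks of two
   consecutive ones (a last block may be single). A bit per block says which of
   its two coordinates to exchange between a and b; this turns (a, b) into a pair
   of midpoints, and for fixed bits x it is an involution sigma_x on pairs. So
   |S| |T| 2^d counts the (x, p) with x in {0,1}^d (bits in excess being ignored),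
   p in M x M and sigma_x p in S x T, where M is the set of midpoints. For fixed
   p, any two such bit strings x, y agree in at least d_*(S, T) / 2
   places, since sigma_x p supplies a point of S and sigma_y p a point of T which
   differ only in the blocks where x and y agree. A concentration inequality on
   the cube, proved by induction on the dimension, bounds the number of such x by
   2^d exp (- d_*^2 / (8 d)), whence |S| |T| <= |M|^2 exp (- d_*^2 / (8 d)). *)

Require Import Defs.
From mathcomp Require Import classical_sets reals ereal sequences exp.
From mathcomp Require Import topology normedtype derive.
From mathcomp Require Import all_boot all_order all_algebra.
From mathcomp Require Import zify ring lra.

Set Implicit Arguments.
Unset Strict Implicit.
Unset Printing Implicit Defensive.

Import Order.TTheory GRing.Theory Num.Theory numFieldNormedType.Exports.

Local Open Scope ring_scope.

(** * A Gaussian bound on the hyperbolic cosine *)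

(** The difference of the two sides vanishes at 0 and has derivative [x * (expR x - expR (- x))],
    nonnegative for [x >= 0]. *)
Lemma sinh_le_mul_cosh (R : realType) (t : R) : 0 <= t ->
  expR t - expR (- t) <= t * (expR t + expR (- t)).
Proof.
move=> t0.
pose k (x : R) := x * (expR x + expR (- x)) - (expR x - expR (- x)).
have dk (x : R) : is_derive x 1 k (x * (expR x - expR (- x))).
  by apply: is_derive_eq; rewrite !scaler1 /GRing.scale /=; ring.
have [|c] := MVT_segment t0 (fun x _ => dk x).
  apply: derivable_within_continuous => x _; exact: ex_derive.
rewrite in_itv /= => /andP[c0 _].
rewrite /k subr0 oppr0 expR0 mul0r subrr !subr0 => kt.
rewrite -subr_ge0 kt; apply: mulr_ge0 => //; apply: mulr_ge0 => //.
by rewrite subr_ge0 ler_expR; lra.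
Qed.

(** The quotient [k] of the left side by [expR (x ^+ 2 / 2)] equals 2 at 0, and by
    [sinh_le_mul_cosh] its derivative is nonpositive. *)
Lemma cosh_le_expR_sqr (R : realType) (t : R) : 0 <= t ->
  expR t + expR (- t) <= 2 * expR (t ^+ 2 / 2).
Proof.
move=> t0.
pose k (x : R) := (expR x + expR (- x)) * expR (- (x ^+ 2 / 2)).
have dk (x : R) : is_derive x 1 k
   (((expR x - expR (- x)) - x * (expR x + expR (- x))) * expR (- (x ^+ 2 / 2))).
  by apply: is_derive_eq; rewrite !scaler1 /GRing.scale /=; field.
have [|c] := MVT_segment t0 (fun x _ => dk x).
  apply: derivable_within_continuous => x _; exact: ex_derive.
rewrite in_itv /= => /andP[c0 _].
rewrite /k subr0 expr0n /= mul0r oppr0 expR0 mulr1 => kt.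
have : k t <= 2.
  suff : k t - 2 <= 0 by lra.
  rewrite /k kt mulr_le0_ge0// mulr_le0_ge0 ?expR_ge0//.
  by rewrite subr_le0 sinh_le_mul_cosh.
by rewrite /k [expR (- (_ / _))]expRN ler_pdivrMr ?expR_gt0.
Qed.

(** * Concentration on the discrete cube *)

Definition agree n (x y : n.-tuple bool) : nat :=
  (\sum_(i < n) (tnth x i == tnth y i))%N.

Lemma agree_cons n a b (x y : n.-tuple bool) :
  agree [tuple of a :: x] [tuple of b :: y] = ((a == b) + agree x y)%N.
Proof.
rewrite /agree big_ord_recl !tnth0; congr addn.
by apply: eq_bigr => i _; rewrite !tnthS.
Qed.

Lemma big_tuple_cons (R : nmodType) n (F : n.+1.-tuple bool -> R) :
  \sum_x F x = \sum_(x : n.-tuple bool) F [tuple of true :: x]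
    + \sum_(x : n.-tuple bool) F [tuple of false :: x].
Proof.
have behead_size (x : n.+1.-tuple bool) : size (behead x) == n.
  by rewrite size_behead size_tuple.
pose h (p : bool * n.-tuple bool) : n.+1.-tuple bool := [tuple of p.1 :: p.2].
have hbij : bijective h.
  exists (fun x : n.+1.-tuple bool => (thead x, Tuple (behead_size x))).
    by case=> b x; rewrite /h /= theadE; congr pair; apply: val_inj.
  by move=> x; rewrite [RHS]tuple_eta; apply: val_inj.
rewrite (reindex h) /=; last exact: onW_bij.
by rewrite -(pair_bigA _ (fun b x => F (h (b, x)))) big_bool.
Qed.

(** For [M > 0], expand [(M * E - a) * (M * E - b) >= 0], bound [a * b] by [M ^+ 2] and divide by
    [M * E]. *)
Lemma add_le_of_mul_le_sqr (R : realFieldType) (M E a b : R) :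
  0 < E -> 0 <= M -> 0 <= a -> 0 <= b -> a <= M * E -> b <= M * E ->
  a * b <= M ^+ 2 -> a + b <= M * (E + E^-1).
Proof.
move=> E0; rewrite le_eqVlt => /predU1P[<-|M0] a0 b0 aM bM abM.
  by move: aM bM; rewrite !mul0r; lra.
have ME0 : 0 < M * E by rewrite mulr_gt0.
rewrite -(ler_pM2l ME0).
have -> : M * E * (M * (E + E^-1)) = (M * E) ^+ 2 + M ^+ 2.
  by field; rewrite gt_eqF.
have : 0 <= (M * E - a) * (M * E - b) by rewrite mulr_ge0// subr_ge0.
nra.
Qed.

(** Splitting both sums by the first bit gives four products, each bounded by induction with [C]
    replaced by [C * E ^+ (b == c)]. The two with unequal bits contribute the term 2, the two with
    equal bits [E + E^-1]. *)
Lemma sum_mul_sum_le_of_agree (R : realFieldType) n (E C : R)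
    (f g : n.-tuple bool -> R) :
  0 < E -> 0 <= C -> (forall x, 0 <= f x) -> (forall x, 0 <= g x) ->
  (forall x y, f x * g y <= C * E ^+ agree x y) ->
  (\sum_x f x) * (\sum_x g x) <= C * (E + E^-1 + 2) ^+ n.
Proof.
move=> E0; elim: n C f g => [|n IHn] C f g C0 f0 g0 fg.
  have sum0 (h : 0.-tuple bool -> R) : \sum_x h x = h [tuple].
    by rewrite (big_pred1 [tuple]) // => x; rewrite [x]tuple0 /=; apply/esym/eqP.
  rewrite !sum0.
  by have := fg [tuple] [tuple]; rewrite /agree big_ord0.
pose fb b (x : n.-tuple bool) := f [tuple of b :: x].
pose gb b (x : n.-tuple bool) := g [tuple of b :: x].
set K := E + E^-1 + 2 in IHn *.
have K0 : 0 <= K by rewrite !addr_ge0 ?invr_ge0// ltW.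
have sE b c : (\sum_x fb b x) * (\sum_x gb c x) <= C * E ^+ (b == c) * K ^+ n.
  apply: IHn => [|x|x|x y]; [| exact: f0 | exact: g0 |].
    by rewrite mulr_ge0// exprn_ge0// ltW.
  by have := fg [tuple of b :: x] [tuple of c :: y];
    rewrite agree_cons exprD mulrA.
have s0 b : 0 <= \sum_x fb b x by apply: sumr_ge0 => x _; exact: f0.
have t0 b : 0 <= \sum_x gb b x by apply: sumr_ge0 => x _; exact: g0.
rewrite !big_tuple_cons.
have := sE true true; have := sE true false; have := sE false true.
have := sE false false; rewrite /= expr0 expr1 mulr1 -![C * E * _]mulrAC.
have := s0 true; have := s0 false; have := t0 true; have := t0 false.
rewrite /fb /gb.
set s := \sum_x _; set s' := \sum_x _; set t := \sum_x _; set t' := \sum_x _.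
set M := C * K ^+ n => h1 h2 h3 h4 h5 h6 h7 h8.
have M0 : 0 <= M by rewrite mulr_ge0// exprn_ge0.
rewrite exprS mulrCA -/M.
(* The two equal-bit products have the same product as the two unequal-bit ones, hence at most
   [M ^+ 2]. *)
have : t * s + t' * s' <= M * (E + E^-1).
  apply: add_le_of_mul_le_sqr => //; rewrite ?mulr_ge0//.
  have := ler_pM _ _ h6 h7; rewrite !mulr_ge0// => /(_ isT isT); nra.
rewrite /K; nra.
Qed.

(** Exponential moment argument: the product inequality with [E = expR (2 * t)] bounds
    [#|F| ^+ 2 * expR (t * delta)] by [4 ^+ d * expR (d * t ^+ 2)], and [t] is then optimised. *)
Lemma card_le_of_agree (R : realType) d (delta : nat) (F : {set d.-tuple bool}) :
  (0 < d)%N ->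
  (forall x y, x \in F -> y \in F -> (delta <= 2 * agree x y)%N) ->
  #|F|%:R <= 2 ^+ d * expR (- (delta%:R ^+ 2 / (8 * d%:R))) :> R.
Proof.
move=> d_gt0 dF.
have d0 : (0 : R) < d%:R by rewrite ltr0n.
(* The minimiser of d t^2 - delta t. *)
have [t tE] : exists t : R, t = delta%:R / (2 * d%:R) by eexists.
have t0 : 0 <= t by rewrite tE divr_ge0// mulr_ge0// ltW.
pose f (x : d.-tuple bool) : R := (x \in F)%:R.
pose g (x : d.-tuple bool) : R := (x \in F)%:R * expR (t * delta%:R).
have fE : \sum_x f x = #|F|%:R.
  rewrite -sumr_const [RHS]big_mkcond; apply: eq_bigr => x _.
  by rewrite /f; case: ifP.
have gE : \sum_x g x = #|F|%:R * expR (t * delta%:R).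
  by rewrite -mulr_suml -fE.
have K_le : expR (2 * t) + (expR (2 * t))^-1 + 2 <= 4 * expR (t ^+ 2).
  have -> : expR (2 * t) + (expR (2 * t))^-1 + 2 = (expR t + expR (- t)) ^+ 2.
    rewrite expRM_natl expRN.
    by field; rewrite gt_eqF ?expR_gt0.
  have -> : 4 * expR (t ^+ 2) = (2 * expR (t ^+ 2 / 2)) ^+ 2.
    rewrite [RHS]exprMn -expRM_natl mulrCA divff// mulr1; ring.
  by rewrite lerXn2r ?nnegrE ?addr_ge0 ?mulr_ge0 ?expR_ge0// cosh_le_expR_sqr.
have fg x y : f x * g y <= 1 * expR (2 * t) ^+ agree x y.
  rewrite /f /g mul1r; have [xF|_] := boolP (x \in F); last first.
    by rewrite mul0r exprn_ge0 ?expR_ge0.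
  have [yF|_] := boolP (y \in F); last by rewrite mul0r mulr0 exprn_ge0 ?expR_ge0.
  rewrite !mul1r -expRM_natl ler_expR.
  have -> : (agree x y)%:R * (2 * t) = t * (2 * agree x y)%:R by rewrite natrM; ring.
  by rewrite ler_wpM2l// ler_nat dF.
have := sum_mul_sum_le_of_agree (expR_gt0 (2 * t)) ler01 _ _ fg.
rewrite fE gE mul1r => /(_ (fun=> ler0n _ _)).
move=> /(_ (fun=> mulr_ge0 (ler0n _ _) (expR_ge0 _))) fg_le.
have K_pow_le : (expR (2 * t) + (expR (2 * t))^-1 + 2) ^+ d
    <= (4 * expR (t ^+ 2)) ^+ d.
  by rewrite lerXn2r ?nnegrE ?addr_ge0 ?mulr_ge0 ?invr_ge0 ?expR_ge0.
rewrite -ler_sqr ?nnegrE ?ler0n ?mulr_ge0 ?exprn_ge0 ?expR_ge0//.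
rewrite -(ler_pM2r (expR_gt0 (t * delta%:R))) expr2 -mulrA.
apply: le_trans fg_le (le_trans K_pow_le _).
rewrite !exprMn -!expRM_natl -exprM mulnC exprM -mulrA -expRD.
rewrite le_eqVlt; apply/orP; left; apply/eqP.
congr (_ * expR _); first by congr (_ ^+ _); ring.
by rewrite tE; field; rewrite gt_eqF.
Qed.

(** * Counting in blocks of two consecutive ranks *)

(* Selects exactly one of the positions [2 j] and [2 j + 1], according to the
   bit [x j]. *)
Definition alternate (x : nat -> bool) (k : nat) : bool := x k./2 (+) odd k.

Lemma count_alternate (x : nat -> bool) n :
  count (alternate x) (iota 0 n) = (n./2 + (odd n && x n./2))%N.
Proof.
elim: n => // n IHn.
rewrite -addn1 iotaD count_cat IHn /= /alternate add0n addn1 /=.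
by rewrite uphalf_half; case: (odd n) => /=; case: (x n./2) => /=; lia.
Qed.

Lemma count_alternate_mid (x : nat -> bool) n :
  count (alternate x) (iota 0 n) \in [:: n./2; uphalf n].
Proof.
rewrite count_alternate uphalf_half !inE.
by case: (odd n); case: (x _) => /=; lia.
Qed.

Lemma count_half_double (q : pred nat) n :
  count (fun k => q k./2) (iota 0 n.*2) = (2 * count q (iota 0 n))%N.
Proof.
elim: n => // n IHn.
have -> : n.+1.*2 = (n.*2 + 2)%N by lia.
rewrite iotaD count_cat IHn -[n.+1]addn1 iotaD count_cat /= !add0n doubleK.
by have -> := uphalf_double n; lia.
Qed.

(** Extend the range from [n] to [d.*2], where each [j < d] is the half of exactly two numbers. *)
Lemma count_half_le (q : pred nat) n d : (n <= d)%N ->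
  (count (fun k => q k./2) (iota 0 n) <= 2 * count q (iota 0 d))%N.
Proof.
move=> n_le; rewrite -count_half_double.
have -> : d.*2 = (n + (d.*2 - n))%N by lia.
by rewrite iotaD count_cat leq_addr.
Qed.

Lemma card_set_index (T : finType) (D : {set T}) (q : pred nat) :
  #|[set i in D | q (index i (enum D))]| = count q (iota 0 #|D|).
Proof.
have -> : iota 0 #|D| = [seq index i (enum D) | i <- enum D].
  apply: (@eq_from_nth _ 0%N) => [|k]; rewrite size_iota ?size_map -?cardE// => kD.
  (* A rank below [#|D|] yields an element of [T], the default that [nth] requires. *)
  have i0 : T by move: kD; rewrite cardE; case: (enum D).
  by rewrite nth_iota// (nth_map i0) -?cardE// index_uniq ?enum_uniq -?cardE.
rewrite count_map cardE -size_filter; congr size.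
rewrite -filter_predI.
by apply: eq_filter => i; rewrite /= !inE andbC.
Qed.

Lemma agreeE d (x y : d.-tuple bool) :
  agree x y = count (fun k => nth false x k == nth false y k) (iota 0 d).
Proof.
rewrite /agree -sum1_count [RHS]big_mkcond /=.
have -> : iota 0 d = index_iota 0 d by rewrite /index_iota subn0.
rewrite big_mkord; apply: eq_bigr => i _.
by rewrite !(tnth_nth false); case: eqP.
Qed.

(** * The crossover involution on pairs of points *)

Section Crossover.
Variables (d : nat) (H : 'I_d -> finType).
Local Notation Omega := {dffun forall i : 'I_d, H i}.
Local Notation dist := (@l0_dist d H).
Implicit Types (p : Omega * Omega) (W : {set 'I_d}) (x y : d.-tuple bool).

Definition diff p : {set 'I_d} := [set i | p.1 i != p.2 i].

Definition mix W (u v : Omega) : Omega :=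
  [ffun i => if i \in W then v i else u i].

(* A block is a pair of coordinates of ranks [2 j], [2 j + 1] in the increasing
   enumeration of [D]; the bits beyond the last block are not read. *)
Definition selector (D : {set 'I_d}) x : {set 'I_d} :=
  [set i in D | alternate (nth false x) (index i (enum D))].

Definition crossover x p : Omega * Omega :=
  let W := selector (diff p) x in (mix W p.1 p.2, mix W p.2 p.1).

(** Exchanged entries still differ, so a second crossover reads the same blocks and undoes the
    first. *)
Lemma diff_crossover x p : diff (crossover x p) = diff p.
Proof.
apply/setP => i; rewrite !inE !ffunE.
by case: ifP => // _; rewrite eq_sym.
Qed.

Lemma crossoverK x : involutive (crossover x).
Proof.
move=> p; rewrite /crossover -/(crossover x p) diff_crossover.
set W := selector _ _; case: p @W => u v W /=.
by congr pair; apply/ffunP => i; rewrite !ffunE -/W; case: (i \in W).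
Qed.

Lemma selector_sub D x : selector D x \subset D.
Proof. by apply/subsetP => i; rewrite inE => /andP[]. Qed.

Lemma card_selector D x :
  #|selector D x| \in [:: #|D|./2; uphalf #|D|].
Proof. by rewrite card_set_index count_alternate_mid. Qed.

Lemma l0_dist_diff (u v : Omega) : dist u v = #|diff (u, v)|.
Proof. by []. Qed.

Lemma l0_dist_sym (u v : Omega) : dist u v = dist v u.
Proof. by apply: eq_card => i; rewrite !inE eq_sym. Qed.

Lemma dist_mix_l W (u v : Omega) : W \subset diff (u, v) ->
  dist u (mix W u v) = #|W|.
Proof.
move=> /subsetP WD; apply: eq_card => i; rewrite !inE ffunE.
by case: ifP => [/WD|_]; [rewrite inE | rewrite eqxx].
Qed.

Lemma dist_mix_r W (u v : Omega) : W \subset diff (u, v) ->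
  dist (mix W u v) v = (dist u v - #|W|)%N.
Proof.
move=> WD; rewrite !l0_dist_diff -[in RHS](setIidPr WD) -cardsD; apply: eq_card => i.
by rewrite !inE /= ffunE; case: (i \in W); rewrite ?eqxx.
Qed.

(** The first point is at distance [#|W|] from [p.1], the second at distance [#|W|] from [p.2]. When
    the distance is odd they round oppositely, which the symmetric definition of [midpoints]
    allows. *)
Lemma crossover_midpoints x p :
  (crossover x p).1 \in midpoints dist p.1 p.2 /\
  (crossover x p).2 \in midpoints dist p.1 p.2.
Proof.
case: p => a b; rewrite /crossover /=.
have := selector_sub (diff (a, b)) x; have := card_selector (diff (a, b)) x.
set W := selector _ _; rewrite -l0_dist_diff => cW WD.
have WD' : W \subset diff (b, a).
  by apply: subset_trans WD _; apply/subsetP => i; rewrite !inE eq_sym.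
have WleD : (#|W| <= dist a b)%N by rewrite subset_leq_card.
have EW := uphalf_half (dist a b); have Eo := odd_double_half (dist a b).
rewrite !inE (l0_dist_sym a (mix W b a)) (l0_dist_sym (mix W b a) b).
rewrite !dist_mix_l// !dist_mix_r// (l0_dist_sym b a).
by move: cW; rewrite !inE; split; lia.
Qed.

(* Within a block of two consecutive differing coordinates, the first point of
   [crossover x p] and the second point of [crossover y p] differ exactly when
   [x] and [y] agree on that block. *)
Lemma dist_crossover x y p :
  (dist (crossover x p).1 (crossover y p).2 <= 2 * agree x y)%N.
Proof.
case: p => u v; rewrite l0_dist_diff agreeE.
set q := fun k => _ == _; pose D := diff (u, v).
suff -> : diff ((crossover x (u, v)).1, (crossover y (u, v)).2) =
    [set i in D | q (index i (enum D))./2].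
  rewrite (card_set_index D (fun k => q k./2)); apply: count_half_le.
  by rewrite -[d in leqRHS]card_ord max_card.
apply/setP => i; rewrite !inE !ffunE /= !inE -/D /alternate /q.
case: (eqVneq (u i) (v i)) => [->|uv] /=; first by rewrite eqxx.
case: (nth _ x _); case: (nth _ y _); case: (odd _) => /=;
  rewrite ?eqxx ?uv 1?eq_sym ?uv//.
Qed.

End Crossover.

(** * Double counting and the curvature bound *)

Lemma crossover_set_midpoints d (H : 'I_d -> finType)
    (S U : {set {dffun forall i : 'I_d, H i}}) x p :
  let M := set_midpoints (@l0_dist d H) S U in
  p \in setX S U -> crossover x p \in setX M M.
Proof.
move=> M; rewrite !inE => /andP[pS pU].
have [m1 m2] := crossover_midpoints x p.
by apply/andP; split; apply/bigcupP; exists p.1 => //; apply/bigcupP; exists p.2.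
Qed.

Lemma brunn_minkowski_l0 (R : realType) d (H : 'I_d -> finType)
    (S U : {set {dffun forall i : 'I_d, H i}}) :
  (0 < d)%N ->
  Num.sqrt (#|S|%:R * #|U|%:R)
    * expR (1 / (16%:R * d%:R) * (set_dist (@l0_dist d H) S U)%:R ^+ 2)
  <= #|set_midpoints (@l0_dist d H) S U|%:R :> R.
Proof.
move=> d_gt0; have d0 : (0 : R) < d%:R by rewrite ltr0n.
set M := set_midpoints _ S U; set delta := set_dist _ S U.
pose F p := [set x : d.-tuple bool | crossover x p \in setX S U].
pose c : R := expR (- (delta%:R ^+ 2 / (8 * d%:R))).
have F_le p : #|F p|%:R <= 2 ^+ d * c.
  apply: card_le_of_agree => // x y; rewrite !inE => /andP[xS _] /andP[_ yU].
  exact: leq_trans (set_dist_le (@l0_dist d H) xS yU) (dist_crossover x y p).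
have count_le : (#|setX S U| * 2 ^ d <= \sum_(p in setX M M) #|F p|)%N.
  have card_cube : #|{: d.-tuple bool}| = (2 ^ d)%N by rewrite card_tuple card_bool.
  rewrite -card_cube mulnC -sum_nat_const.
  under [leqRHS]eq_bigr do rewrite -sum1_card.
  rewrite (exchange_big_dep predT) //=; apply: leq_sum => x _.
  (* For fixed [x], the injective [crossover x] sends [setX S U] to pairs [q] of midpoints with [x]
     in [F q]. *)
  rewrite -(card_imset _ (inv_inj (crossoverK x))) -sum1_card.
  rewrite [leqRHS]big_mkcond [leqLHS]big_mkcond /=; apply: leq_sum => q _.
  case: imsetP => // -[p pSU ->].
  by rewrite crossover_set_midpoints// inE crossoverK pSU.
have card_le : #|S|%:R * #|U|%:R <= #|M|%:R ^+ 2 * c.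
  rewrite -(@ler_pM2r _ (2 ^+ d)) ?exprn_gt0//.
  rewrite -natrM -cardsX -natrX -natrM.
  apply: (@le_trans _ _ (\sum_(p in setX M M) #|F p|)%:R); first by rewrite ler_nat.
  rewrite natr_sum; apply: (le_trans (ler_sum _ (fun p _ => F_le p))).
  rewrite sumr_const cardsX -[leLHS]mulr_natl natrM natrX expr2 -!mulrA.
  by rewrite [c * _]mulrC.
rewrite -ler_sqr ?nnegrE ?ler0n ?mulr_ge0 ?sqrtr_ge0 ?expR_ge0//.
rewrite exprMn sqr_sqrtr ?mulr_ge0//.
(* Squaring doubles the exponent to [delta ^+ 2 / (8 * d)], which cancels [c]. *)
apply: le_trans (ler_wpM2r (exprn_ge0 _ (expR_ge0 _)) card_le) _.
rewrite -expRM_natl -[leLHS]mulrA /c -expRD.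
rewrite [X in expR X](_ : _ = 0) ?expR0 ?mulr1//.
by field; rewrite gt_eqF.
Qed.

Theorem theorem1p7 (R : realType) (d : nat) (hd : (1 <= d)%N)
    (H : 'I_d -> finType) (hH : forall i : 'I_d, (0 < #|H i|)%N) :
  ((1 / (2%:R * d%:R) : R)%:E <= bm_curvature R (@l0_dist d H))%E
  /\ (forall S U : {set {dffun forall i : 'I_d, H i}},
        S != set0 -> U != set0 ->
        #|set_midpoints (@l0_dist d H) S U|%:R
        >= Num.sqrt (#|S|%:R * #|U|%:R)
             * expR (1 / (16%:R * d%:R)
                       * (set_dist (@l0_dist d H) S U)%:R ^+ 2) :> R).
Proof.
have d0 : (0 : R) < d%:R by rewrite ltr0n.
split=> [|S U _ _]; last exact: brunn_minkowski_l0.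
apply: ereal_sup_ubound; exists (1 / (2%:R * d%:R)) => // S U _ _.
have -> : 1 / (2%:R * d%:R) / 8%:R = 1 / (16%:R * d%:R) :> R.
  by field; rewrite gt_eqF.
exact: brunn_minkowski_l0.
Qed.
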